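(* Let $\mathcal{C}$ be a collection of nonempty compact subsets of $\mathbb{R}^d$. Suppose that $\dim_P\mathcal{C}\le k$, where $k\in\{1,2,\ldots\}$, and that for every $K\in\mathcal{C}$ we have $K=\overline{\mathrm{int}\,K}$ and $\overline{\dim}_B\,\partial K=d-1$. Then an element of $\mathcal{C}$ can be reconstructed using $2k+1$ test sets.
   Context: $\lambda^d$ denotes Lebesgue measure on $\mathbb{R}^d$. For a family $\mathcal{A}$ of Lebesgue measurable subsets of $\mathbb{R}^d$ of finite measure, an element of $\mathcal{A}$ can be reconstructed using $n$ test sets if there exist measurable sets $T_1,\ldots,T_n\subset\mathbb{R}^d$ such that whenever $A,B\in\mathcal{A}$ and $\lambda^d(A\cap T_i)=\lambda^d(B\cap T_i)$ for every $i=1,\ldots,n$, then $A=B$. The collection $\mathcal{C}$ is regarded as a subset of the metric space $(\mathcal{K}(\mathbb{R}^d),d_H)$ of nonempty compact subsets of $\mathbb{R}^d$ with the Hausdorff metric, and $\dim_P\mathcal{C}$ is taken in this metric space. In a metric space $X$, the upper box dimension of a bounded set $A\subset X$ is $\overline{\dim}_B(A)=\inf\{s:\limsup_{\varepsilon\to0}N(A,\varepsilon)\varepsilon^s=0\}$, where $N(A,\varepsilon)$ is the smallest number of $\varepsilon$-balls in $X$ needed to cover $A$. The packing dimension of $A\subset X$ is $\dim_P(A)=\inf\{\sup_i\overline{\dim}_B(A_i): A_i\text{ is bounded and }A\subset\bigcup_{i=1}^\infty A_i\}$. The boundary $\partial K$ and its upper box dimension are taken in $\mathbb{R}^d$. 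*)

(* Defs.v *)
From HB Require Import structures.
From mathcomp Require Import all_boot all_order all_algebra.
From mathcomp Require Import all_classical all_reals all_analysis.

Set Implicit Arguments.
Unset Strict Implicit.
Unset Printing Implicit Defensive.

Import Order.TTheory GRing.Theory Num.Theory.
Import numFieldNormedType.Exports.

Local Open Scope classical_set_scope.
Local Open Scope ring_scope.

(* R^d is 'rV[R]_d with the library's (product) topology. The library's norm on
   'rV[R]_d is the sup norm, so the Euclidean distance is spelled out here. *)
Definition eucl_dist (R : realType) (d : nat) (x y : 'rV[R]_d) : R :=
  Num.sqrt (\sum_(i < d) (x ord0 i - y ord0 i) ^+ 2).

Section MetricNotions.
Context {R : realType} {X : Type} (dist : X -> X -> R).
Implicit Types (A B : set X) (x : X) (e : R).

Definition dball x e : set X := [set y | dist x y < e].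

Definition dbounded A : Prop :=
  exists M : R, forall x y, A x -> A y -> dist x y <= M.

(* +oo when no finite cover exists; centres range over the whole space X *)
Definition covering_number A e : \bar R :=
  ereal_inf [set (n%:R)%:E | n in
    [set n : nat | exists c : 'I_n -> X, A `<=` \bigcup_i dball (c i) e]].

(* s ranges over all reals: for nonempty A the infimum is nonnegative anyway,
   and the empty set gets dimension -oo. *)
Definition upper_box_dim A : \bar R :=
  ereal_inf [set s%:E | s in
    [set s : R |
      limf_esup (fun e : R => covering_number A e * (e `^ s)%:E)%E 0^'+ = 0%E]].

Definition packing_dim A : \bar R :=
  ereal_inf [set ereal_sup (range (fun i => upper_box_dim (F i))) | F in
    [set F : (set X)^nat |
      (forall i, dbounded (F i)) /\ A `<=` \bigcup_i F i]].

Definition dist_to_set x A : R := inf [set dist x y | y in A].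

Definition hausdorff_dist A B : R :=
  Num.max (sup [set dist_to_set x B | x in A])
          (sup [set dist_to_set y A | y in B]).

End MetricNotions.

(* Nonemptiness and compactness make every sup and inf in hausdorff_dist range
   over a nonempty bounded set of reals. *)
Definition ncompact (R : realType) (d : nat) : Type :=
  {K : set 'rV[R]_d | K !=set0 /\ compact K}.

Definition ncompact_dist (R : realType) (d : nat) (K L : ncompact R d) : R :=
  hausdorff_dist (@eucl_dist R d) (sval K) (sval L).

Definition boundary (T : topologicalType) (A : set T) : set T :=
  closure A `\` interior A.

(* Lebesgue outer measure on R^d for d > 0: infimum of the total volumes of
   countable covers by closed, possibly degenerate, boxes. *)
Definition box (R : realType) (d : nat) (a b : 'rV[R]_d) : set 'rV[R]_d :=
  [set x | forall i, a ord0 i <= x ord0 i <= b ord0 i].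

Definition box_vol (R : realType) (d : nat) (a b : 'rV[R]_d) : R :=
  \prod_(i < d) (b ord0 i - a ord0 i).

Definition lebesgue_rV (R : realType) (d : nat) (A : set 'rV[R]_d) : \bar R :=
  ereal_inf [set (\sum_(0 <= n <oo) (box_vol (ab n).1 (ab n).2)%:E)%E | ab in
    [set ab : nat -> 'rV[R]_d * 'rV[R]_d |
      (forall n i, (ab n).1 ord0 i <= (ab n).2 ord0 i) /\
      A `<=` \bigcup_n box (ab n).1 (ab n).2]].

(* Lebesgue measurability is Caratheodory measurability for the outer measure;
   Lebesgue measure is its restriction to these sets. *)
Definition lebesgue_measurable (R : realType) (d : nat)
    (A : set 'rV[R]_d) : Prop :=
  (@lebesgue_rV R d).-caratheodory A.

Definition reconstructible (R : realType) (d : nat)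
    (F : set (set 'rV[R]_d)) (n : nat) : Prop :=
  exists T : 'I_n -> set 'rV[R]_d,
    (forall i, lebesgue_measurable (T i)) /\
    forall A B, F A -> F B ->
      (forall i, lebesgue_rV (A `&` T i) = lebesgue_rV (B `&` T i)) -> A = B.

(* Main.v *)
Require Import Defs.
From HB Require Import structures.
From mathcomp Require Import all_boot all_order all_algebra.
From mathcomp Require Import all_classical all_reals all_analysis.
From mathcomp Require Import measurable_realfun.
From mathcomp Require Import ring lra zify.

Set Implicit Arguments.
Unset Strict Implicit.
Unset Printing Implicit Defensive.

Import Order.TTheory GRing.Theory Num.Theory.
Import numFieldNormedType.Exports.

Local Open Scope classical_set_scope.
Local Open Scope ring_scope.

(** The test sets are found by a Baire category argument among tuples of
    measurable sets, with the measure of the symmetric difference as distance.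

    Two distinct members [A], [B] of the collection are regular closed, so up to
    exchanging them a cube from a countable family lies in [A] and misses [B]
    ([exists_cube_in_setD]).  The pairs of members thus split into countably many
    pieces, each attached to one cube, to one member of a countable cover of the
    collection by sets of upper box dimension at most slightly above [k] for each
    of [A] and [B], and to one scale below which the covering numbers of the boundaries
    are controlled.  It suffices that, for each piece, the test tuples which
    separate all its pairs with a positive margin are open and dense
    ([exists_separating_tests]).  Openness is immediate, since moving a test set
    by a small measure moves the measures of its intersections by as little.

    For density ([perturb_tests]) change each of the [2 * k + 1] test sets only
    inside a thin slab of the cube, into a part of prescribed measure.  As the
    slab lies in [A] and misses [B], this shifts the difference between the
    measures of the two intersections by the prescribed amount, which ranges
    over a grid of [L ^ (2 * k + 1)] points.  Cover the two families by Hausdorff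
    balls of radius [e].  If two sets are at Hausdorff distance less than [2 * e],
    the points of one outside the other lie within [2 * e] of the boundary of the
    latter ([boundary_near]), hence form a set of measure about [e], because the
    boundary has dimension one less than the space ([lebesgue_rV_setD_le]).  So a
    pair of balls spoils at most one grid point as soon as the mesh is somewhat
    coarser than [e], that is for [L] somewhat smaller than [e ^- 1].  There are
    about [e ^- (2 * k)] pairs of balls and [e ^- (2 * k + 1)] grid points, and
    the missing factor [e] absorbs the losses in the exponents: some grid point
    is spoiled by no pair.  Restricting [e] to the powers [m ^- mesh_exp] turns
    all these exponents into natural numbers ([radiusE], [grid_larger]).

    The measure theory this rests on is that the outer measure defined by covers
    by closed boxes gives boxes their volume and makes them measurable.  The
    lower bound for the volume ([box_vol_le_cover]) comes from integrating
    indicators one coordinate at a time. *)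

(** * Lebesgue outer measure and measurability of boxes *)

Section LebesgueOuterMeasure.
Context {R : realType}.

Lemma box_vol_ge0 d (a b : 'rV[R]_d) :
  (forall i, a ord0 i <= b ord0 i) -> 0 <= box_vol a b.
Proof. by move=> ab; apply: prodr_ge0 => i _; rewrite subr_ge0. Qed.

Definition box_cover d (A : set 'rV[R]_d) (ab : nat -> 'rV[R]_d * 'rV[R]_d) :=
  (forall n i, (ab n).1 ord0 i <= (ab n).2 ord0 i) /\
  A `<=` \bigcup_n box (ab n).1 (ab n).2.

Local Notation vol ab := (box_vol ab.1 ab.2)%:E.

Lemma lebesgue_rV_le_cover d (A : set 'rV[R]_d) ab : box_cover A ab ->
  (lebesgue_rV A <= \sum_(0 <= n <oo) vol (ab n))%E.
Proof. by move=> Aab; apply: ereal_inf_lbound; exists ab. Qed.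

Lemma lebesgue_rV_ge0 d (A : set 'rV[R]_d) : (0 <= lebesgue_rV A)%E.
Proof.
apply: le_ereal_inf_tmp => _ [ab [abP _] <-]; apply: nneseries_ge0 => n _ _.
by rewrite lee_fin box_vol_ge0.
Qed.

Lemma le_lebesgue_rV d :
  {homo (@lebesgue_rV R d) : A B / A `<=` B >-> (A <= B)%E}.
Proof.
move=> A B AB; apply/ereal_inf_le_tmp => x [ab [abP Bab] <-].
by exists ab => //; split => //; exact: subset_trans AB Bab.
Qed.

(** The other boxes of the cover degenerate to the corner [a]: they have volume
    zero because the dimension is positive. *)
Lemma lebesgue_rV_box_le d (a b : 'rV[R]_d.+1) :
  (forall i, a ord0 i <= b ord0 i) ->
  (lebesgue_rV (box a b) <= (box_vol a b)%:E)%E.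
Proof.
move=> ab; pose c n := if n is 0%N then (a, b) else (a, a).
apply: le_trans (lebesgue_rV_le_cover (ab := c) _) _.
  by split=> [[|n] i//|x xab]; exists 0%N.
rewrite nneseries_recl//; last first.
  by move=> n _; rewrite lee_fin box_vol_ge0//; case: n => [|n] i /=.
rewrite eseries_cond/= eseries0 ?adde0// => -[|n]//= _ _.
by rewrite /box_vol big_ord_recl subrr mul0r.
Qed.

Lemma lebesgue_rV0 d : @lebesgue_rV R d.+1 set0 = 0%E.
Proof.
apply/eqP; rewrite eq_le lebesgue_rV_ge0 andbT.
apply: le_trans (le_lebesgue_rV (@sub0set _ (box 0 0))) _.
apply: le_trans (lebesgue_rV_box_le (a := 0) (b := 0) _) _ => //.
by rewrite /box_vol big_ord_recl subrr mul0r.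
Qed.

(** Nearly optimal covers of the sets, with errors summing up to [e], are
    enumerated along a bijection between [nat] and [nat * nat]. *)
Lemma lebesgue_rV_sigma_subadditive d : sigma_subadditive (@lebesgue_rV R d).
Proof.
move=> A; have [[i ioo]|] := pselect (exists i, lebesgue_rV (A i) = +oo%E).
  rewrite (eseries_pinfty _ _ ioo) ?leey// => n _.
  by rewrite -ltNye (lt_le_trans _ (lebesgue_rV_ge0 _)).
rewrite -forallNE => Aoo.
suff add2e (e : {posnum R}) : (lebesgue_rV (\bigcup_n A n) <=
    \sum_(0 <= i <oo) lebesgue_rV (A i) + e%:num%:E)%E.
  by apply/lee_addgt0Pr => _/posnumP[].
rewrite (le_trans _ (epsilon_trick _ _ _))//; last first.
  by move=> n; exact: lebesgue_rV_ge0.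
pose P n ab := box_cover (A n) ab /\
  (\sum_(0 <= k <oo) vol (ab k) <=
     lebesgue_rV (A n) + (e%:num / (2 ^ n.+1)%:R)%:E)%E.
have [G PG] : {G & forall n, P n (G n)}.
  apply: choice => n.
  have en1 : 0 < e%:num / (2 ^ n.+1)%:R :> R by [].
  have Afin : lebesgue_rV (A n) \is a fin_num.
    rewrite fin_numElt (lt_le_trans _ (lebesgue_rV_ge0 _))//=.
    by rewrite ltey; apply/eqP; exact: Aoo.
  have [_ [ab Aab <-] abA] := lb_ereal_inf_adherent en1 Afin.
  by exists ab; split => //; exact: ltW.
pose v (ij : nat * nat) := (vol (G ij.1 ij.2)).
have v0 ij : (0 <= v ij)%E by rewrite lee_fin box_vol_ge0//; exact: (PG _).1.1.
have /card_esym/ppcard_eqP[f] := card_nat2.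
have cov : box_cover (\bigcup_n A n) (fun n => G (f n).1 (f n).2).
  split=> [n i|x [i _ /((PG i).1.2 x) [j _ xij]]]; first exact: (PG _).1.1.
  by exists (f^-1%FUN (i, j)) => //=; rewrite invK ?inE.
apply: le_trans (lebesgue_rV_le_cover cov) _.
have -> : (\sum_(0 <= n <oo) vol (G (f n).1 (f n).2) =
           \sum_(0 <= n <oo) (v \o f) n)%E by [].
rewrite nneseries_esumT; last by move=> n; exact: v0.
rewrite -(@reindex_esum _ _ _ [set: nat] [set: nat * nat] f v)//.
rewrite (_ : [set: nat * nat] = [set: nat] `*`` (fun=> [set: nat])); last first.
  by apply/seteqP; split.
rewrite -(esum_esum (a := fun i j => v (i, j)))//.
rewrite -nneseries_esumT; last by move=> i; exact: esum_ge0.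
apply: lee_nneseries => [i _ _|i _]; first exact: esum_ge0.
rewrite -(nneseries_esumT (a := fun j => v (i, j))); first exact: (PG i).2.
by move=> j; exact: v0.
Qed.

HB.instance Definition _ d := isOuterMeasure.Build R 'rV[R]_d.+1
  (@lebesgue_rV R d.+1) (lebesgue_rV0 d) (@lebesgue_rV_ge0 d.+1)
  (@le_lebesgue_rV d.+1) (@lebesgue_rV_sigma_subadditive d.+1).

(** The bounding hyperplane cuts every box of a cover into two boxes whose
    volumes add up.  Leaving open which points of the hyperplane belong to [H]
    yields both the closed half-spaces and the complements of the opposite
    ones. *)
Lemma lebesgue_measurable_halfspace d (i : 'I_d.+1) (t : R)
    (H : set 'rV[R]_d.+1) :
  [set x : 'rV_d.+1 | x ord0 i < t] `<=` H ->
  H `<=` [set x : 'rV_d.+1 | x ord0 i <= t] ->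
  lebesgue_measurable H.
Proof.
move=> ltH Hle.
apply: le_caratheodory_measurable => X.
apply: le_ereal_inf_tmp => _ [ab [abP Xab] <-].
pose clamp (g : R -> R) (a : 'rV[R]_d.+1) : 'rV[R]_d.+1 :=
  \row_j (if j == i then g (a ord0 i) else a ord0 j).
pose lo n := (clamp (Num.min t) (ab n).1, clamp (Num.min t) (ab n).2).
pose hi n := (clamp (Num.max t) (ab n).1, clamp (Num.max t) (ab n).2).
have clampP (g : R -> R) n : {homo g : u v / u <= v} ->
    forall j, clamp g (ab n).1 ord0 j <= clamp g (ab n).2 ord0 j.
  by move=> gh j; rewrite !mxE; case: ifP => _; [apply: gh|]; exact: abP.
have minh : {homo Num.min t : u v / u <= v} by move=> u v uv; exact: le_min2.
have maxh : {homo Num.max t : u v / u <= v} by move=> u v uv; exact: le_max2.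
have loX : box_cover (X `&` H) lo.
  split=> [n j|x [/Xab[n _ xn] /Hle xt]]; first exact: clampP.
  exists n => // j; rewrite !mxE; case: eqP => [->|_]; last exact: xn.
  have /andP[ax xb] := xn i.
  by rewrite le_min xt xb andbT ge_min ax orbT.
have hiX : box_cover (X `&` ~` H) hi.
  split=> [n j|x [/Xab[n _ xn] Hx]]; first exact: clampP.
  have tx : t <= x ord0 i by rewrite leNgt; apply/negP => /ltH.
  exists n => // j; rewrite !mxE; case: eqP => [->|_]; last exact: xn.
  have /andP[ax xb] := xn i.
  by rewrite ge_max tx ax /= le_max xb orbT.
apply: le_trans (leeD (lebesgue_rV_le_cover loX) (lebesgue_rV_le_cover hiX)) _.
rewrite -nneseriesD; last 2 first.
- by move=> n _ _; rewrite lee_fin box_vol_ge0//; exact: clampP.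
- by move=> n _ _; rewrite lee_fin box_vol_ge0//; exact: clampP.
rewrite le_eqVlt; apply/orP; left; apply/eqP; apply: eq_eseriesr => n _.
rewrite -EFinD; congr (_%:E).
have volE (g : R -> R) : box_vol (clamp g (ab n).1) (clamp g (ab n).2) =
    (g ((ab n).2 ord0 i) - g ((ab n).1 ord0 i)) *
    \prod_(j < d.+1 | j != i) ((ab n).2 ord0 j - (ab n).1 ord0 j).
  rewrite /box_vol (bigD1 i)//= !mxE eqxx; congr (_ * _).
  by apply: eq_bigr => j /negPf ji; rewrite !mxE ji.
rewrite !volE -mulrDl [RHS](bigD1 i)//=; congr (_ * _).
by have := addr_max_min t ((ab n).2 ord0 i);
  have := addr_max_min t ((ab n).1 ord0 i); lra.
Qed.

Lemma lebesgue_measurable_box d (a b : 'rV[R]_d.+1) :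
  lebesgue_measurable (box a b).
Proof.
pose L (i : 'I_d.+1) := [set x : 'rV[R]_d.+1 | x ord0 i < a ord0 i].
pose U (i : 'I_d.+1) := [set x : 'rV[R]_d.+1 | x ord0 i <= b ord0 i].
(* the d.+1 coordinates are padded to a sequence by the full space *)
pose cut m := if insub m is Some i then ~` L i `&` U i else setT.
have -> : box a b = ~` \bigcup_m ~` cut m.
  apply/seteqP; split=> [x xab [m _]|x xcut i].
    rewrite /cut; case: insubP => [i _ _|_ /(_ I)//]; apply.
    by split; have /andP[ax xb] := xab i => //; apply/negP; rewrite -leNgt.
  have : cut i x by apply: contrapT => cx; apply: xcut; exists (i : nat).
  by rewrite /cut valK => -[/negP + xb]; rewrite -leNgt => ->.
apply: caratheodory_measurable_setC.
apply: caratheodory_measurable_bigcup => m.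
apply: caratheodory_measurable_setC; rewrite /cut.
case: insubP => [i _ _|_]; last first.
  by rewrite -setC0; apply: caratheodory_measurable_setC;
    exact: caratheodory_measurable_set0.
apply: caratheodory_measurable_setI.
  apply: caratheodory_measurable_setC.
  by apply: (@lebesgue_measurable_halfspace _ i (a ord0 i)) => // x /ltW.
by apply: (@lebesgue_measurable_halfspace _ i (b ord0 i)) => // x /ltW.
Qed.

End LebesgueOuterMeasure.

(** * The outer measure of a box is its volume *)

Section BoxVolume.
Context {R : realType}.
Local Notation leb := (@lebesgue_measure R).

Lemma integral_scaled_itv (c a b : R) : 0 <= c -> a <= b ->
  (\int[leb]_x (c * \1_(`[a, b]) x)%:E)%E = (c * (b - a))%:E.
Proof.
move=> c0 ab; under eq_integral do rewrite EFinM.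
rewrite ge0_integralZl//; last exact/measurable_EFinP.
rewrite integral_indic// setIT.
have leE : leb `[a, b] = (b - a)%:E.
  rewrite lebesgue_measure_itv/= lte_fin; case: ltP => // ba.
  by rewrite (_ : a = b) ?subrr//; apply/eqP; rewrite eq_le ab ba.
by rewrite EFinM; congr (_ * _)%E.
Qed.

Lemma scaled_itv_cover (c a b : R) (w p q : nat -> R) :
  0 <= c -> a <= b -> (forall n, 0 <= w n) -> (forall n, p n <= q n) ->
  (forall x, (c * \1_(`[a, b]) x)%:E <=
     \sum_(0 <= n <oo) (w n * \1_(`[p n, q n]) x)%:E)%E ->
  ((c * (b - a))%:E <= \sum_(0 <= n <oo) (w n * (q n - p n))%:E)%E.
Proof.
move=> c0 ab w0 pq le_cover.
have term0 n x : (0 <= (w n * \1_(`[p n, q n]) x)%:E)%E.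
  by rewrite lee_fin mulr_ge0.
have mterm (v u t : R) :
    measurable_fun setT (fun x : R => (v * \1_(`[u, t]) x)%:E).
  by apply/measurable_EFinP; exact: measurable_funM.
rewrite -integral_scaled_itv//.
apply: le_trans (_ : (\int[leb]_x
    \sum_(0 <= n <oo) (w n * \1_(`[p n, q n]) x)%:E <= _)%E).
  apply: ge0_le_integral => //.
  - by move=> x _; rewrite lee_fin mulr_ge0.
  - exact: mterm.
  - by apply: (@ge0_emeasurable_sum _ _ _ setT _ xpredT) => // n _; exact: mterm.
rewrite integral_nneseries//; last by move=> n; exact: mterm.
by apply: lee_nneseries => [n _ _|n _];
  [exact: integral_ge0 | rewrite integral_scaled_itv].
Qed.

(** The indicator of a box is a product of indicators of intervals, so the
    covering inequality between indicators can be integrated one coordinate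
    after the other. *)
Lemma box_vol_le_cover d (a b : 'rV[R]_d) ab :
  (forall i, a ord0 i <= b ord0 i) -> box_cover (box a b) ab ->
  ((box_vol a b)%:E <= \sum_(0 <= n <oo) (box_vol (ab n).1 (ab n).2)%:E)%E.
Proof.
move=> leab [abP cov].
(* the coordinates below m have been integrated out *)
pose side m (a b x : 'rV[R]_d) (i : 'I_d) : R :=
  if (i < m)%N then b ord0 i - a ord0 i
  else \1_(`[a ord0 i, b ord0 i]) (x ord0 i).
have side_ge0 m (u v x : 'rV[R]_d) i : (forall i, u ord0 i <= v ord0 i) ->
    0 <= side m u v x i.
  by move=> uv; rewrite /side; case: ifP => // _; rewrite subr_ge0.
have sides_ge0 m n x :
    (0 <= (\prod_i side m (ab n).1 (ab n).2 x i)%:E)%E.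
  by rewrite lee_fin; apply: prodr_ge0 => i _; exact: side_ge0.
have main m : (m <= d)%N -> forall x, ((\prod_i side m a b x i)%:E <=
    \sum_(0 <= n <oo) (\prod_i side m (ab n).1 (ab n).2 x i)%:E)%E.
  elim: m => [_ x|m IH md x].
    have [xab|] := pselect (box a b x).
      have [n _ xn] := cov x xab.
      have inbox (u v : 'rV[R]_d) : box u v x -> \prod_i side 0%N u v x i = 1.
        move=> xuv; apply: big1 => i _; rewrite /side ltn0 indicE mem_set//=.
        by rewrite in_itv/=; exact: xuv.
      apply: (@le_trans _ _ (\prod_i side 0%N (ab n).1 (ab n).2 x i)%:E).
        by rewrite !inbox.
      apply: le_trans (nneseries_lim_ge n.+1 _); last first.
        by move=> j _ _; exact: sides_ge0.
      rewrite big_nat_recr//= leeDr//; apply: sume_ge0 => j _.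
      exact: sides_ge0.
    move=> /existsNP[i xi]; rewrite (bigD1 i)//= {1}/side ltn0 indicE.
    rewrite memNset ?mul0r; last by rewrite /= in_itv/=.
    apply: nneseries_ge0 => j _ _.
    exact: sides_ge0.
  pose im := Ordinal md.
  pose rest (u v : 'rV[R]_d) := \prod_(i | i != im) side m u v x i.
  have restS (u v : 'rV[R]_d) :
      \prod_i side m.+1 u v x i = rest u v * (v ord0 im - u ord0 im).
    rewrite (bigD1 im)//= mulrC {2}/side /= ltnSn; congr (_ * _).
    apply: eq_bigr => i ne; rewrite /side ltnS leq_eqVlt.
    by rewrite (_ : (i == m :> nat) = false)//; apply: negbTE ne.
  pose xt t : 'rV[R]_d := \row_i (if i == im then t else x ord0 i).
  have rest_xt (u v : 'rV[R]_d) t : \prod_i side m u v (xt t) i =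
      rest u v * \1_(`[u ord0 im, v ord0 im]) t.
    rewrite (bigD1 im)//= mulrC {2}/side /= ltnn mxE eqxx; congr (_ * _).
    by apply: eq_bigr => i ne; rewrite /side mxE (negbTE ne).
  rewrite restS.
  under eq_eseriesr do rewrite restS.
  apply: scaled_itv_cover => //.
  - by apply: prodr_ge0 => i _; exact: side_ge0.
  - by move=> n; apply: prodr_ge0 => i _; exact: side_ge0.
  - move=> t; rewrite -rest_xt; under eq_eseriesr do rewrite -rest_xt.
    exact: IH (ltnW md) _.
have volE (u v : 'rV[R]_d) : \prod_i side d u v 0 i = box_vol u v.
  by apply: eq_bigr => i _; rewrite /side ltn_ord.
have := main d (leqnn d) 0; rewrite volE.
by under eq_eseriesr do rewrite volE.
Qed.

Lemma lebesgue_rV_box d (a b : 'rV[R]_d.+1) :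
  (forall i, a ord0 i <= b ord0 i) -> lebesgue_rV (box a b) = (box_vol a b)%:E.
Proof.
move=> ab; apply/eqP; rewrite eq_le lebesgue_rV_box_le//=.
by apply: le_ereal_inf_tmp => _ [c cP <-]; exact: box_vol_le_cover.
Qed.

End BoxVolume.

(** * Covers obtained from dimension bounds *)

Section BoxDimension.
Context {R : realType} {X : Type} (dist : X -> X -> R).

Lemma packing_dim_lt_cover (A : set X) (s : \bar R) :
  (packing_dim dist A < s)%E ->
  exists F : (set X)^nat, A `<=` \bigcup_i F i /\
    forall i, (upper_box_dim dist (F i) < s)%E.
Proof.
move=> /ereal_inf_lt[_ [F [_ AF] <-] Fs]; exists F; split => // i.
by apply: le_lt_trans Fs; apply: ereal_sup_ubound; exists i.
Qed.

(** The rational exponent lets the bound on the number of balls be a natural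
    power when the radii are restricted to the powers [m ^- N]. *)
Lemma upper_box_dim_lt_cover (A : set X) (p N : nat) : (0 < N)%N ->
  (upper_box_dim dist A < (p%:R / N%:R)%:E)%E ->
  exists m0 : nat, forall m : nat, (m0 < m)%N ->
    exists M (c : 'I_M -> X), (M <= m ^ p)%N /\
      A `<=` \bigcup_i dball dist (c i) (m%:R ^- N).
Proof.
move=> N0 /ereal_inf_lt[_ [s limA <-]]; rewrite lte_fin => sp.
have [_ [V V0 <-] supV] : exists2 y, [set ereal_sup
    [set (covering_number dist A e * (e `^ s)%:E)%E | e in V] | V in 0^'+] y
    & (y < 1%:E)%E.
  by apply: ereal_inf_lt; rewrite [X in (X < _)%E]limA lte_fin.
have [del /= del0 delV] :
    exists2 del : R, 0 < del & forall e, 0 < e -> e < del -> V e.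
  have [del /= del0 delV] := V0; exists del => // e e0 edel; apply: delV => //=.
  by rewrite sub0r normrN gtr0_norm.
exists (Num.truncn del^-1) => m mgt.
have del_m : del^-1 < m%:R.
  by apply: lt_le_trans (truncnS_gt _) _; rewrite ler_nat.
have m0 : 0 < m%:R :> R by apply: lt_trans del_m; rewrite invr_gt0.
have m_ge1 : 1 <= m%:R :> R by move: m0; rewrite ltr0n -(ler_nat R).
set e : R := m%:R ^- N.
have e0 : 0 < e by rewrite invr_gt0 exprn_gt0.
have e_le : e <= m%:R^-1.
  rewrite /e lef_pV2 ?posrE ?exprn_gt0//.
  by rewrite -[leLHS]expr1; apply: ler_weXn2l.
have e1 : e <= 1 by apply: le_trans e_le _; rewrite invf_le1.
have eV : V e.
  apply: delV => //; apply: le_lt_trans e_le _.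
  by rewrite -[ltRHS]invrK ltf_pV2 ?posrE ?invr_gt0.
have : (covering_number dist A e * (e `^ s)%:E < 1%:E)%E.
  by apply: le_lt_trans supV; apply: ereal_sup_ubound; exists e.
rewrite muleC -lte_pdivlMl ?powR_gt0// mule1.
move=> /ereal_inf_lt[_ [M [c Ac] <-]]; rewrite lte_fin => Mlt.
exists M, c; split => //.
rewrite -(ler_nat R) natrX; apply: le_trans (ltW Mlt) _.
have -> : m%:R ^+ p = e `^ (- (p%:R / N%:R)) :> R.
  have -> : e = m%:R^-1 `^ N%:R by rewrite powR_mulrn ?invr_ge0// exprVn.
  rewrite powRN -powRrM mulrCA divff ?mulr1 ?pnatr_eq0 -?lt0n//.
  by rewrite powR_mulrn ?invr_ge0 ?ler0n// exprVn invrK.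
rewrite -powRN; apply: ger_powR; first by rewrite e0.
by rewrite lerN2 ltW.
Qed.

End BoxDimension.

(** * Hausdorff distance and neighborhoods of the boundary *)

(** The point of [K] nearest to [x] cannot be interior, since moving from it
    towards [x] decreases the distance. *)
Lemma boundary_near (R : realType) (V : normedModType R) (K : set V) x z
    (r : R) :
  compact K -> ~ K x -> K z -> `|x - z| < r ->
  exists2 p, boundary K p & `|x - p| < r.
Proof.
move=> cK nKx Kz xzr.
have cont : {within K, continuous (fun y => `|x - y|)}.
  apply: continuous_subspaceT => y; apply: cvg_norm.
  by apply: cvgB; [exact: cvg_cst|exact: cvg_id].
have [p /set_mem Kp pmin] := compact_EVT_min (ex_intro _ z Kz) cK cont.
exists p; last by apply: le_lt_trans xzr; apply: pmin; exact/mem_set.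
split; first exact: subset_closure.
move=> intp.
have toward : p + t *: (x - p) @[t --> (0 : R)^'+] --> p.
  rewrite -[X in _ --> X]addr0; apply: cvgD; first exact: cvg_cst.
  rewrite -(scale0r (x - p)); apply: cvgZr_tmp.
  exact: cvg_within.
have near1 : \forall t \near (0 : R)^'+, t < 1 by exact: nbhs_right_lt.
have near0 : \forall t \near (0 : R)^'+, 0 < t.
  exact: nbhs_right_gt.
have nearK : \forall t \near (0 : R)^'+, K (p + t *: (x - p)).
  exact: toward _ intp.
have [t [[Kt t1] t0]] := filter_ex (filterI (filterI nearK near1) near0).
have := pmin _ (mem_set Kt); rewrite leNgt => /negP; apply.
rewrite (_ : x - _ = (1 - t) *: (x - p)); last first.
  by rewrite scalerBl scale1r opprD addrA.
rewrite normrZ gtr0_norm ?subr_gt0// gtr_pMl ?ltrBlDr ?ltrDl//.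
by rewrite normr_gt0 subr_eq0; apply: contra_notN nKx => /eqP ->.
Qed.

Section HausdorffDistance.
Context {R : realType} {d : nat}.
Implicit Types (x y : 'rV[R]_d) (A B K : set 'rV[R]_d).

Lemma coord_le_norm x i : `|x ord0 i| <= `|x|.
Proof.
rewrite [leRHS]/Num.norm/= mx_normrE.
by apply: (le_bigmax _ (fun ij : 'I_1 * 'I_d => `|x ij.1 ij.2|) (ord0, i)).
Qed.

Lemma norm_rV_lt x (e : R) : 0 < e -> (forall i, `|x ord0 i| < e) -> `|x| < e.
Proof.
move=> e0 xe; rewrite [ltLHS]/Num.norm/= mx_normrE; apply/bigmax_ltP; split => //.
by move=> [i j] _ /=; rewrite ord1.
Qed.

Lemma coord_le_eucl_dist x y i : `|x ord0 i - y ord0 i| <= eucl_dist x y.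
Proof.
rewrite -sqrtr_sqr /eucl_dist ler_sqrt; last first.
  by apply: sumr_ge0 => j _; exact: sqr_ge0.
rewrite (bigD1 i)//= lerDl; apply: sumr_ge0 => j _; exact: sqr_ge0.
Qed.

Lemma norm_lt_of_eucl_dist x y (e : R) : eucl_dist x y < e -> `|x - y| < e.
Proof.
move=> xye; apply: norm_rV_lt; first by apply: le_lt_trans xye; exact: sqrtr_ge0.
by move=> i; rewrite !mxE; apply: le_lt_trans xye; exact: coord_le_eucl_dist.
Qed.

Lemma compact_norm_le A : compact A -> exists M : R, forall x, A x -> `|x| <= M.
Proof.
move=> /compact_bounded[M [_ AM]].
by exists (M + 1) => x; apply: AM; rewrite ltrDl.
Qed.

Lemma eucl_dist_bounded A B : compact A -> compact B ->
  exists M : R, forall x y, A x -> B y -> eucl_dist x y <= M.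
Proof.
move=> /compact_norm_le[a Aa] /compact_norm_le[b Bb].
exists (Num.sqrt (\sum_(i < d) (a + b) ^+ 2)) => x y Ax By.
rewrite /eucl_dist ler_sqrt; last by apply: sumr_ge0 => i _; exact: sqr_ge0.
apply: ler_sum => i _; rewrite -real_normK ?num_real//.
have xa := le_trans (coord_le_norm x i) (Aa x Ax).
have yb := le_trans (coord_le_norm y i) (Bb y By).
rewrite ler_sqr ?nnegrE//; last first.
  by apply: addr_ge0; [apply: le_trans xa|apply: le_trans yb].
by apply: le_trans (ler_normB _ _) _; exact: lerD.
Qed.

(** Compactness gives the upper bound without which the supremum would carry no
    information. *)
Lemma near_of_sup_dist_lt A B (e : R) : compact A -> compact B -> B !=set0 ->
  sup [set dist_to_set (@eucl_dist R d) x B | x in A] < e ->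
  forall x, A x -> exists2 y, B y & `|x - y| < e.
Proof.
move=> cA cB [b Bb] supe x Ax.
have has_inf_dist z : has_inf [set eucl_dist z y | y in B].
  by split; [exists (eucl_dist z b), b|exists 0 => _ [y _ <-]; exact: sqrtr_ge0].
have [M ABM] := eucl_dist_bounded cA cB.
have xe : dist_to_set (@eucl_dist R d) x B < e.
  apply: le_lt_trans supe; apply: ub_le_sup; last by exists x.
  exists M => _ [z Az <-]; apply: le_trans (ABM z b Az Bb).
  by apply: ge_inf; [exact: (has_inf_dist z).2|exists b].
have [_ [y By <-] xy] := inf_lt (has_inf_dist x).1 xe.
by exists y => //; exact: norm_lt_of_eucl_dist.
Qed.

Lemma near_of_ncompact_dist_lt (K L : ncompact R d) (e : R) :
  ncompact_dist K L < e ->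
  (forall x, sval K x -> exists2 y, sval L y & `|x - y| < e) /\
  (forall y, sval L y -> exists2 x, sval K x & `|x - y| < e).
Proof.
case: K L => [K [K0 cK]] [L [L0 cL]]/=.
rewrite /ncompact_dist /hausdorff_dist gt_max/= => /andP[KL LK].
split; first exact: near_of_sup_dist_lt.
move=> y Ly; have [x Kx xy] := near_of_sup_dist_lt cL cK K0 LK Ly.
by exists x => //; rewrite distrC.
Qed.

Lemma two_points_in_dball (c K L : ncompact R d) (e : R) :
  dball (@ncompact_dist R d) c e K -> dball (@ncompact_dist R d) c e L ->
  forall x, sval K x -> exists2 y, sval L y & `|x - y| < e + e.
Proof.
move=> /near_of_ncompact_dist_lt[_ cK] /near_of_ncompact_dist_lt[cL _] x Kx.
have [z cz zx] := cK x Kx; have [y Ly zy] := cL z cz; exists y => //.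
rewrite -(subrKA z); apply: le_lt_trans (ler_normD _ _) _.
by rewrite ltrD// distrC.
Qed.

End HausdorffDistance.

Section BoundaryNeighborhood.
Context {R : realType} {d : nat}.

Lemma outer_measure_finite_subadditive T (mu : {outer_measure set T -> \bar R})
    n (F : 'I_n -> set T) :
  (mu (\bigcup_i F i) <= \sum_(i < n) mu (F i))%E.
Proof.
pose G m := if insub m is Some i then F i else set0.
have GF (i : 'I_n) : G i = F i by rewrite /G valK.
have -> : \bigcup_i F i = \big[setU/set0]_(i < n) G i.
  rewrite -(bigcup_mkord _ G); apply/seteqP; split=> [x [i _ Fx]|x [m /= mn]].
    by exists (i : nat); rewrite /= ?GF.
  by rewrite -[m]/(val (Ordinal mn)) GF => Fx; exists (Ordinal mn).
apply: le_trans (outer_measure_subadditive _ _ _) _.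
by under eq_bigr do rewrite GF.
Qed.

(** A point of [K] outside [L] is within [e + e] of the boundary of [L], hence
    within [3 * e] of one of the [M] centers in the sup norm: the boxes of side
    [6 * e] around the centers cover the difference. *)
Lemma lebesgue_rV_setD_le (K L : set 'rV[R]_d.+1) M (c : 'I_M -> 'rV[R]_d.+1)
    (e : R) : 0 < e -> compact L ->
  (forall x, K x -> exists2 y, L y & `|x - y| < e + e) ->
  boundary L `<=` \bigcup_i dball (@eucl_dist R d.+1) (c i) e ->
  (lebesgue_rV (K `\` L) <= (M%:R * (6 * e) ^+ d.+1)%:E)%E.
Proof.
move=> e0 cL nearL bL.
pose lo i : 'rV[R]_d.+1 := \row_j (c i ord0 j - 3 * e).
pose hi i : 'rV[R]_d.+1 := \row_j (c i ord0 j + 3 * e).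
have cov : K `\` L `<=` \bigcup_i box (lo i) (hi i).
  move=> x [Kx nLx]; have [y Ly xy] := nearL x Kx.
  have [p /bL[i _ pi] xp] := boundary_near cL nLx Ly xy.
  exists i => // j; rewrite !mxE.
  have := le_lt_trans (coord_le_norm _ j) xp; rewrite !mxE ltr_norml.
  have := le_lt_trans (coord_le_eucl_dist _ _ j) pi; rewrite ltr_norml.
  by move=> *; lra.
apply: le_trans (le_lebesgue_rV cov) _.
apply: le_trans (outer_measure_finite_subadditive (@lebesgue_rV R d.+1) _) _.
rewrite (eq_bigr (fun=> ((6 * e) ^+ d.+1)%:E)).
  by rewrite sumEFin lee_fin sumr_const card_ord [leRHS]mulr_natl.
move=> i _; transitivity (box_vol (lo i) (hi i))%:E.
  by apply: lebesgue_rV_box => j; rewrite !mxE; lra.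
congr (_%:E); rewrite /box_vol (eq_bigr (fun=> 6 * e)).
  by rewrite prodr_const card_ord.
by move=> j _; rewrite !mxE; lra.
Qed.

End BoundaryNeighborhood.

(** * Separating countably many families of pairs *)

Section TestSets.
Context {R : realType} {V : Type} (mu : {outer_measure set V -> \bar R}).
Implicit Types (A B : set V).

Lemma fin_num_outer_measure A B : A `<=` B -> (mu B < +oo)%E ->
  mu A \is a fin_num.
Proof.
move=> AB Boo; rewrite fin_numElt (lt_le_trans _ (outer_measure_ge0 mu A))//=.
exact: le_lt_trans (le_outer_measure mu _ _ AB) Boo.
Qed.

Lemma dist_outer_measure_le A B (r : R) : (mu A < +oo)%E -> (mu B < +oo)%E ->
  (mu (A `\` B) <= r%:E)%E -> (mu (B `\` A) <= r%:E)%E ->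
  `|fine (mu A) - fine (mu B)| <= r.
Proof.
have half A' B' : (mu A' < +oo)%E -> (mu B' < +oo)%E ->
    (mu (A' `\` B') <= r%:E)%E -> fine (mu A') <= fine (mu B') + r.
  move=> Aoo Boo ABr; rewrite -lee_fin EFinD !fineK; last 2 first.
  - exact: fin_num_outer_measure Boo.
  - exact: fin_num_outer_measure Aoo.
  apply: le_trans (_ : (mu (B' `|` (A' `\` B')) <= _)%E).
    apply: le_outer_measure => x Ax.
    by have [Bx|nBx] := pselect (B' x); [left|right].
  by apply: le_trans (outer_measureU2 _ _ _) _; exact: leeD2l.
move=> Aoo Boo ABr BAr; rewrite ler_norml lerBlDr lerBrDl.
by rewrite (addrC r) half//= lerBlDr half.
Qed.

Lemma dist_outer_measureIl_le A B (T : set V) (r : R) :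
  (mu A < +oo)%E -> (mu B < +oo)%E ->
  (mu (A `\` B) <= r%:E)%E -> (mu (B `\` A) <= r%:E)%E ->
  `|fine (mu (A `&` T)) - fine (mu (B `&` T))| <= r.
Proof.
have subI (A' B' : set V) : (A' `&` T) `\` (B' `&` T) `<=` A' `\` B'.
  by move=> x [[Ax Tx] nBT]; split => // Bx; exact: nBT.
have ltyI (A' : set V) : (mu A' < +oo)%E -> (mu (A' `&` T) < +oo)%E.
  by apply: le_lt_trans; apply: le_outer_measure; exact: subIsetl.
move=> Aoo Boo ABr BAr; apply: dist_outer_measure_le; [exact: ltyI..| |].
- by apply: le_trans ABr; apply: le_outer_measure; exact: subI.
- by apply: le_trans BAr; apply: le_outer_measure; exact: subI.
Qed.

Definition symdiff A B := (A `\` B) `|` (B `\` A).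

Lemma dist_outer_measureIr_le A (T T' : set V) (r : R) : (mu A < +oo)%E ->
  (mu (symdiff T T') <= r%:E)%E ->
  `|fine (mu (A `&` T)) - fine (mu (A `&` T'))| <= r.
Proof.
move=> Aoo TTr.
have ltyI (T'' : set V) : (mu (A `&` T'') < +oo)%E.
  by apply: le_lt_trans Aoo; apply: le_outer_measure; exact: subIsetl.
apply: dist_outer_measure_le => //; apply: le_trans TTr;
  apply: le_outer_measure => x [[Ax Tx] nAT].
- by left; split => // T'x; exact: nAT.
- by right; split => // T'x; exact: nAT.
Qed.

Section Limit.
Variable s : (set V)^nat.

(** The inferior limit of the sequence [s]: it provides the limits of Cauchy
    sequences for the measure of the symmetric difference. *)
Definition limit_set := \bigcup_m \bigcap_(l in [set l | (m <= l)%N]) s l.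

Lemma limit_set_caratheodory : (forall l, mu.-caratheodory (s l)) ->
  mu.-caratheodory limit_set.
Proof.
move=> ms; apply: caratheodory_measurable_bigcup => m.
rewrite -[X in _ X]setCK; apply: caratheodory_measurable_setC.
rewrite setC_bigcap bigcup_mkcond.
apply: caratheodory_measurable_bigcup => l; case: ifP => _.
  exact: caratheodory_measurable_setC.
exact: caratheodory_measurable_set0.
Qed.

Lemma limit_set_symdiff m :
  symdiff limit_set (s m) `<=` \bigcup_l symdiff (s (m + l)%N) (s (m + l).+1).
Proof.
move=> x; apply: contraPP => nx.
have stable l : s (m + l)%N x <-> s m x.
  elim: l => [|l IH]; first by rewrite addn0.
  rewrite -IH addnS; split=> sx; apply: contrapT => nsx; apply: nx; exists l => //.
    by right.
  by left.
have lim : limit_set x <-> s m x.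
  split=> [[k _ kx]|mx].
    by apply/(stable k); apply: kx => /=; rewrite leq_addl.
  by exists m => // l /= ml; rewrite -(subnKC ml); exact/stable.
by case=> -[]; rewrite lim.
Qed.

Lemma limit_set_symdiff_le (tau : R^nat) m : 0 <= tau m ->
  (forall l, tau (l.+1) <= tau l / 2) ->
  (forall l, (mu (symdiff (s l) (s l.+1)) <= (tau l)%:E)%E) ->
  (mu (symdiff limit_set (s m)) <= (tau m *+ 2)%:E)%E.
Proof.
move=> tau0 tau_half stau.
have tau_geo l : tau (m + l)%N <= tau m *+ 2 / (2 ^ l.+1)%:R.
  elim: l => [|l IH].
    by rewrite addn0 expn1 -[tau m *+ 2]mulr_natr mulfK.
  rewrite addnS; apply: le_trans (tau_half _) _.
  rewrite expnSr natrM invfM mulrA.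
  by rewrite ler_pM2r// invr_gt0.
apply: le_trans (le_outer_measure mu _ _ (@limit_set_symdiff m)) _.
apply: le_trans (outer_measure_sigma_subadditive mu _) _.
apply: le_trans (_ : (\sum_(0 <= l <oo) (tau m *+ 2 / (2 ^ l.+1)%:R)%:E <= _)%E).
  apply: lee_nneseries => [l _ _|l _]; first exact: outer_measure_ge0.
  by apply: le_trans (stau _) _; rewrite lee_fin; exact: tau_geo.
by apply: epsilon_trick0; rewrite mulrn_wge0.
Qed.

End Limit.

(** A Baire category argument in the complete space of tuples of test sets with
    the measure of the symmetric difference as distance: separating the [j]th
    family of pairs with a margin [gamma] is dense by hypothesis, and open
    because the margin survives perturbations smaller than [gamma / 2]. *)
Lemma exists_separating_tests n (P : nat -> set V -> set V -> Prop) :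
  (forall j A B, P j A B -> (mu A < +oo)%E /\ (mu B < +oo)%E) ->
  (forall j (T : 'I_n -> set V) (tau : R), 0 < tau ->
     (forall i, mu.-caratheodory (T i)) ->
     exists (T' : 'I_n -> set V) (gamma : R),
       [/\ 0 < gamma, forall i, mu.-caratheodory (T' i),
           forall i, (mu (symdiff (T i) (T' i)) <= tau%:E)%E &
           forall A B, P j A B -> exists i,
             gamma <= `|fine (mu (A `&` T' i)) - fine (mu (B `&` T' i))|]) ->
  exists T : 'I_n -> set V, (forall i, mu.-caratheodory (T i)) /\
    forall j A B, P j A B -> exists i, mu (A `&` T i) <> mu (B `&` T i).
Proof.
move=> Pfin dense.
pose valid (s : ('I_n -> set V) * R) :=
  0 < s.2 /\ forall i, mu.-caratheodory (s.1 i).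
(* The limit will be within 2 * s'.2 of s'.1, which moves the difference of the
   two measures by at most 4 * s'.2: with a margin of 8 * s'.2 it stays
   nonzero. *)
pose next (js : nat * (('I_n -> set V) * R)) (s' : ('I_n -> set V) * R) :=
  valid js.2 -> [/\ valid s', s'.2 <= js.2.2 / 2,
    forall i, (mu (symdiff (js.2.1 i) (s'.1 i)) <= js.2.2%:E)%E &
    forall A B, P js.1 A B -> exists i,
      s'.2 *+ 8 <= `|fine (mu (A `&` s'.1 i)) - fine (mu (B `&` s'.1 i))|].
have [f fP] : {f & forall js, next js (f js)}.
  apply: choice => -[j [T tau]]; rewrite /next/=.
  have [[/= tau0 mT]|nv] := pselect (valid (T, tau)); last by exists (T, tau).
  have [T' [gamma [gamma0 mT' TT' sep]]] := dense j T tau tau0 mT.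
  exists (T', Num.min (tau / 2) (gamma / 8)) => _; split => //=.
  - by split => //=; rewrite lt_min !divr_gt0.
  - by rewrite ge_min lexx.
  - move=> A B /sep[i sepi]; exists i; apply: le_trans sepi.
    by rewrite -[leLHS]mulr_natr -ler_pdivlMr// ge_min lexx orbT.
pose s := fix s j := if j is j'.+1 then f (j', s j') else (fun=> set0, 1 : R).
have sS j : s j.+1 = f (j, s j) by [].
have sv j : valid (s j).
  elim: j => [|j IH]; last by rewrite sS; have [] := fP (j, s j) IH.
  by split => //= i; exact: caratheodory_measurable_set0.
pose T i := limit_set (fun j => (s j).1 i).
exists T; split.
  by move=> i; apply: limit_set_caratheodory => j; exact: (sv j).2.
move=> j A B PAB.
have [_ _ _ /(_ A B PAB)[i sepi]] := fP (j, s j) (sv j).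
have [Aoo Boo] := Pfin _ _ _ PAB.
exists i => ABT; move: sepi; rewrite -sS.
have tau0 := (sv j.+1).1; set tau := (s j.+1).2 in tau0 *.
have Tclose : (mu (symdiff (T i) ((s j.+1).1 i)) <= (tau *+ 2)%:E)%E.
  apply: (limit_set_symdiff_le (tau := fun l => (s l).2)); first exact: ltW.
  - by move=> l; rewrite sS; have [] := fP (l, s l) (sv l).
  - by move=> l; rewrite [s l.+1]sS; have [_ _ close _] := fP (l, s l) (sv l);
      exact: close.
have := dist_outer_measureIr_le Aoo Tclose.
have := dist_outer_measureIr_le Boo Tclose.
rewrite ABT !ler_norml -[tau *+ 2]mulr_natr -[tau *+ 8]mulr_natr.
move=> /andP[b1 b2] /andP[a1 a2].
by apply/negP; rewrite -ltNge ltr_norml; apply/andP; split; lra.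
Qed.

(** Inside [S 1], which lies in every first member and misses every second
    member, a grid point [g] prescribes the measures of the new test sets.  The
    members of one class differ by at most [r] in measure.  Distinct grid points
    prescribe measures at least [4 * r] apart for some test set, so they cannot
    both fail to separate pairs of the same class by [r].  Each class thus spoils
    at most one grid point, and there are more grid points than classes. *)
Lemma perturb_tests n (L : nat) (I : finType) (T : 'I_n -> set V)
    (S : R -> set V) (sigma r : R) (P : set V -> set V -> Prop)
    (class : I -> set V -> set V -> Prop) :
  (#|I| < L ^ n)%N -> 0 < r -> 4 * r * L%:R <= sigma ->
  (forall i, mu.-caratheodory (T i)) ->
  (forall t : R, 0 <= t <= 1 -> [/\ mu.-caratheodory (S t),
     mu (S t) = (sigma * t)%:E & S t `<=` S 1]) ->
  (forall A B, P A B -> [/\ (mu A < +oo)%E, (mu B < +oo)%E, S 1 `<=` A,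
     S 1 `&` B = set0 & exists q, class q A B]) ->
  (forall q A B A' B', P A B -> P A' B' -> class q A B -> class q A' B' ->
     (mu (A `\` A') <= r%:E)%E /\ (mu (B `\` B') <= r%:E)%E) ->
  exists T' : 'I_n -> set V, [/\ forall i, mu.-caratheodory (T' i),
    forall i, (mu (symdiff (T i) (T' i)) <= sigma%:E)%E &
    forall A B, P A B -> exists i,
      r <= `|fine (mu (A `&` T' i)) - fine (mu (B `&` T' i))|].
Proof.
move=> cardI r0 rL mT SP Pprop classP.
pose U (g : {ffun 'I_n -> 'I_L}) i := (T i `\` S 1) `|` S ((g i)%:R / L%:R).
have gI (g : {ffun 'I_n -> 'I_L}) i : 0 <= ((g i)%:R / L%:R : R) <= 1.
  have L0 : 0 < L%:R :> R by rewrite ltr0n (leq_ltn_trans _ (ltn_ord (g i))).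
  rewrite divr_ge0//= ler_pdivrMr// mul1r ler_nat; exact/ltnW/ltn_ord.
have [mS1 muS1 _] : [/\ mu.-caratheodory (S 1), mu (S 1) = (sigma * 1)%:E &
  S 1 `<=` S 1] by apply: SP; rewrite ler01 lexx.
have mU g i : mu.-caratheodory (U g i).
  apply: caratheodory_measurable_setU; first exact: caratheodory_measurable_setD.
  by have [] := SP _ (gI g i).
have closeU g i : (mu (symdiff (T i) (U g i)) <= sigma%:E)%E.
  rewrite -[sigma]mulr1 -muS1; apply: le_outer_measure.
  have [_ _ S1] := SP _ (gI g i).
  move=> x [[Tx nU]|[[[Tx nS]|/S1//] nT]] //.
  by apply: contrapT => nS; apply: nU; left.
pose base A B i :=
  fine (mu (A `&` (T i `\` S 1))) - fine (mu (B `&` (T i `\` S 1))).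
have measU A B g i : P A B ->
    fine (mu (A `&` U g i)) - fine (mu (B `&` U g i)) =
    base A B i + sigma * ((g i)%:R / L%:R).
  move=> /Pprop[Aoo Boo S1A S1B _].
  have [_ muS SS1] := SP _ (gI g i).
  have -> : B `&` U g i = B `&` (T i `\` S 1).
    apply/seteqP; split=> [x [Bx [//|/SS1 Sx]]|x [Bx Tx]]; last first.
      by split => //; left.
    by have : set0 x by rewrite -S1B.
  rewrite /base (mS1 (A `&` U g i)).
  have -> : (A `&` U g i) `&` S 1 = S ((g i)%:R / L%:R).
    apply/seteqP; split=> [x [[_ [[_ nS]|//]] //]|x Sx].
    by split; [split; [exact/S1A/SS1|right]|exact: SS1].
  have -> : (A `&` U g i) `&` ~` S 1 = A `&` (T i `\` S 1).
    apply/seteqP; split=> [x [[Ax [//|/SS1 Sx //]]]|x [Ax [Tx nS]]].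
    by split => //; split => //; left.
  rewrite muS fineD//; first by rewrite /=; ring.
  by apply: fin_num_outer_measure Aoo; exact: subIsetl.
suff [g gP] : exists g, forall A B, P A B -> exists i,
    r <= `|fine (mu (A `&` U g i)) - fine (mu (B `&` U g i))|.
  by exists (U g).
apply: contrapT => /forallNP nogood.
have bad g : exists q, exists A B, [/\ P A B, class q A B &
    forall i, `|fine (mu (A `&` U g i)) - fine (mu (B `&` U g i))| < r].
  have /existsNP[A /existsNP[B /not_implyP[PAB /forallNP ABr]]] := nogood g.
  have [_ _ _ _ [q qAB]] := Pprop A B PAB.
  by exists q, A, B; split => // i; rewrite ltNge; exact/negP.
have [code codeP] := choice bad.
have /leq_card : injective code.
  move=> g g' gg'; apply/ffunP => i.
  have [A [B [PAB cAB /(_ i)]]] := codeP g.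
  have [A' [B' [PAB' cAB' /(_ i)]]] := codeP g'.
  rewrite !measU// => bad' bad0; rewrite gg' in cAB.
  have [AA' BB'] := classP _ _ _ _ _ PAB PAB' cAB cAB'.
  have [A'A B'B] := classP _ _ _ _ _ PAB' PAB cAB' cAB.
  have [Aoo Boo _ _ _] := Pprop _ _ PAB.
  have [A'oo B'oo _ _ _] := Pprop _ _ PAB'.
  have := dist_outer_measureIl_le (T i `\` S 1) Aoo A'oo AA' A'A.
  have := dist_outer_measureIl_le (T i `\` S 1) Boo B'oo BB' B'B.
  have L0 : 0 < L%:R :> R by rewrite ltr0n (leq_ltn_trans _ (ltn_ord (g i))).
  have step0 : 4 * r <= sigma / L%:R by rewrite ler_pdivlMr.
  have apart (a b : nat) : (a < b)%N ->
      sigma * (a%:R / L%:R) + 4 * r <= sigma * (b%:R / L%:R).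
    rewrite -(ler_nat R) -natr1 => ab; rewrite ![sigma * (_ / _)]mulrCA.
    by nra.
  move: bad' bad0; rewrite !ltr_norml !ler_norml /base.
  set u := sigma * _; set v := sigma * _.
  move=> /andP[? ?] /andP[? ?] /andP[? ?] /andP[? ?].
  by apply/val_inj => /=; case: (ltngtP (g i) (g' i)) => // /apart;
    rewrite -/u -/v => ?; exfalso; lra.
by rewrite card_ffun !card_ord leqNgt cardI.
Qed.

End TestSets.

(** * Slabs and cubes *)

Section Cubes.
Context {R : realType}.

(** [S t] fills the proportion [t] of a box [S 1] cut out of [box a b] in the
    first coordinate, thin enough to have measure at most [tau]. *)
Lemma exists_slabs d (a b : 'rV[R]_d.+1) (tau : R) :
  (forall i, a ord0 i < b ord0 i) -> 0 < tau ->
  exists (S : R -> set 'rV[R]_d.+1) (sigma : R),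
    [/\ 0 < sigma, sigma <= tau, S 1 `<=` box a b &
        forall t, 0 <= t <= 1 -> [/\ lebesgue_measurable (S t),
          lebesgue_rV (S t) = (sigma * t)%:E & S t `<=` S 1]].
Proof.
move=> ab tau0.
pose rest := \prod_(i < d.+1 | i != ord0) (b ord0 i - a ord0 i).
have rest0 : 0 < rest by apply: prodr_gt0 => i _; rewrite subr_gt0.
pose w := Num.min (b ord0 ord0 - a ord0 ord0) (tau / rest).
have w0 : 0 < w by rewrite lt_min subr_gt0 ab divr_gt0.
have wtau : w <= tau / rest by rewrite ge_min lexx orbT.
have wb : a ord0 ord0 + w <= b ord0 ord0.
  by rewrite addrC -lerBrDr ge_min lexx.
pose hi t : 'rV[R]_d.+1 :=
  \row_j (if j == ord0 then a ord0 ord0 + w * t else b ord0 j).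
exists (fun t => box a (hi t)), (w * rest); split.
- exact: mulr_gt0.
- by rewrite -ler_pdivlMr.
- move=> x xS i; have /andP[-> /=] := xS i; rewrite mxE mulr1.
  by case: eqP => [->|//] xi; exact: le_trans xi wb.
- move=> t /andP[t0 t1]; split; first exact: lebesgue_measurable_box.
  + rewrite lebesgue_rV_box.
      congr (_%:E); rewrite /box_vol (bigD1 ord0)//= mxE eqxx.
      rewrite [a _ _ + _]addrC addrK mulrAC; congr (_ * _ * _).
      by apply: eq_bigr => i i0; rewrite mxE (negbTE i0).
    move=> i; rewrite mxE; case: eqP => [->|_]; last exact: ltW.
    by rewrite lerDl mulr_ge0// ltW.
  + move=> x xS i; have /andP[-> /=] := xS i; rewrite !mxE.
    case: eqP => // _ xi; apply: le_trans xi _.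
    by rewrite lerD2l ler_wpM2l// ltW.
Qed.

Definition cube_lo d (s : nat) (q : 'rV[int]_d) : 'rV[R]_d :=
  \row_j ((q ord0 j)%:~R / s.+1%:R).

Definition cube_hi d (s : nat) (q : 'rV[int]_d) : 'rV[R]_d :=
  \row_j (((q ord0 j)%:~R + 1) / s.+1%:R).

Definition cube d s (q : 'rV[int]_d) := box (cube_lo s q) (cube_hi s q).

Lemma cube_lo_lt_hi d s (q : 'rV[int]_d) i :
  cube_lo s q ord0 i < cube_hi s q ord0 i.
Proof. by rewrite !mxE ltr_pM2r ?invr_gt0// ltrDl. Qed.

Lemma nbhs_cube d (x : 'rV[R]_d) (U : set 'rV[R]_d) : nbhs x U ->
  exists s q, @cube d s q `<=` U.
Proof.
move=> /nbhs_ballP[e /= e0 xeU].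
pose s := Num.truncn e^-1.
have se : s.+1%:R^-1 < e.
  by rewrite -[ltRHS]invrK ltf_pV2 ?posrE ?invr_gt0//; exact: truncnS_gt.
exists s, (\row_j Num.floor (s.+1%:R * x ord0 j)) => y yq.
apply: xeU; rewrite mx_norm_ball /ball_/=.
apply: norm_rV_lt => // j; rewrite !mxE.
have := yq j; rewrite !mxE => /andP[lo hi].
have := floor_le (s.+1%:R * x ord0 j); have := floorD1_gt (s.+1%:R * x ord0 j).
move: lo hi; rewrite ler_pdivrMr// ler_pdivlMr// intrD.
set f := (Num.floor _)%:~R => lo hi gt le.
have s0 : 0 < s.+1%:R :> R by [].
apply: le_lt_trans se; rewrite -[leRHS]mul1r ler_pdivlMr//.
rewrite -[X in _ * X](gtr0_norm s0) -normrM ler_norml mulrBl.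
by apply/andP; split; nra.
Qed.

(** The interior of [K], dense in [K], meets the open complement of [L]; the
    cubes are indexed by a countable type. *)
Lemma exists_cube_in_setD d (K L : set 'rV[R]_d) :
  K = closure (interior K) -> closed L -> ~ K `<=` L ->
  exists s q, @cube d s q `<=` K /\ @cube d s q `&` L = set0.
Proof.
move=> regK clL /existsNP[x /not_implyP[Kx nLx]].
have nbhsx : nbhs x (~` L).
  by apply: open_nbhs_nbhs; split => //; exact: closed_openC.
have [y [intKy nLy]] : interior K `&` ~` L !=set0.
  by move: Kx; rewrite {1}regK => /(_ _ nbhsx).
have nbhsy : nbhs y (interior K `&` ~` L).
  apply: open_nbhs_nbhs; split => //.
  by apply: openI; [exact: open_interior|exact: closed_openC].
have [s [q sqU]] := nbhs_cube nbhsy; exists s, q; split.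
  by apply: subset_trans sqU _ => z [/interior_subset].
by rewrite -subset0 => z [/sqU[]].
Qed.

End Cubes.

(** * Reconstruction from test sets *)

Section Reconstruction.
Context {R : realType} {d k : nat}.
Local Notation ncompact := (ncompact R d.+1).
Local Notation dist := (@ncompact_dist R d.+1).

Lemma compact_lebesgue_rV_lty (K : set 'rV[R]_d.+1) : compact K ->
  (lebesgue_rV K < +oo)%E.
Proof.
move=> /compact_norm_le[M KM]; pose c : 'rV[R]_d.+1 := \row__ `|M|.
have Kbox : K `<=` box (- c) c.
  move=> x Kx i; rewrite !mxE -ler_norml; apply: le_trans (coord_le_norm x i) _.
  by apply: le_trans (KM x Kx) _; exact: ler_norm.
apply: le_lt_trans (le_lebesgue_rV Kbox) _; rewrite lebesgue_rV_box ?ltry// => i.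
by rewrite !mxE; apply: (@le_trans _ _ 0); rewrite ?oppr_le0.
Qed.

(** For radii [m ^- N] and grids of [m ^ (N - 2)] steps, the number of steps
    times the error is of order [m ^- 1] ([radiusE]), and the grid points
    outnumber the pairs of balls ([grid_larger]) as soon as [4 * k + 4 < N]. *)
Definition mesh_exp := (4 * k + 5)%N.

(** The covering condition at all scales finer than [m0] that a boundary of
    dimension [d] in dimension [d.+1] satisfies for some [m0]. *)
Definition thin_boundary (m0 : nat) (K : set 'rV[R]_d.+1) :=
  forall m, (m0 < m)%N -> exists M (c : 'I_M -> 'rV[R]_d.+1),
    (M <= m ^ (mesh_exp * d + 1))%N /\
    boundary K `<=` \bigcup_i dball (@eucl_dist R d.+1) (c i) (m%:R ^- mesh_exp).

Lemma thin_boundaryS m0 m1 K : (m0 <= m1)%N ->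
  thin_boundary m0 K -> thin_boundary m1 K.
Proof. by move=> m01 thinK m m1m; apply: thinK; exact: leq_ltn_trans m1m. Qed.

Definition family_cover (m0 : nat) (F : set ncompact) :=
  forall m, (m0 < m)%N -> exists M (c : 'I_M -> ncompact),
    (M <= m ^ (mesh_exp * k + 1))%N /\
    F `<=` \bigcup_i dball dist (c i) (m%:R ^- mesh_exp).

(** The piece of the family of pairs to which [perturb_tests] applies
    uniformly. *)
Definition pair_piece (F G : set ncompact) m0 s q (A B : set 'rV[R]_d.+1) :=
  exists K L : ncompact, [/\ sval K = A, sval L = B, F K, G L &
    [/\ thin_boundary m0 A, thin_boundary m0 B,
        @cube R d.+1 s q `<=` A & @cube R d.+1 s q `&` B = set0]].

Lemma pair_piece_lty F G m0 s q A B : pair_piece F G m0 s q A B ->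
  (lebesgue_rV A < +oo)%E /\ (lebesgue_rV B < +oo)%E.
Proof.
move=> [[K [? cK]] [[L [? cL]] [/= <- <- _ _ _]]].
by split; exact: compact_lebesgue_rV_lty.
Qed.

(** The bound of [lebesgue_rV_setD_le] for [m ^ (mesh_exp * d + 1)] balls of
    radius [m ^- mesh_exp]. *)
Definition radius (m : nat) : R :=
  m%:R ^+ (mesh_exp * d + 1) * (6 * m%:R ^- mesh_exp) ^+ d.+1.

Lemma radius_setD m0 m (c K L : ncompact) : (m0 < m)%N ->
  thin_boundary m0 (sval L) ->
  dball dist c (m%:R ^- mesh_exp) K -> dball dist c (m%:R ^- mesh_exp) L ->
  (lebesgue_rV (sval K `\` sval L) <= (radius m)%:E)%E.
Proof.
move=> m0m /(_ m m0m)[M [cb [Mm bL]]] cK cL.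
have m_gt0 : 0 < m%:R :> R by rewrite ltr0n (leq_ltn_trans _ m0m).
have e0 : 0 < m%:R ^- mesh_exp :> R by rewrite invr_gt0 exprn_gt0.
apply: le_trans (lebesgue_rV_setD_le e0 (svalP L).2 _ bL) _.
  exact: two_points_in_dball cK cL.
rewrite lee_fin /radius ler_pM2r ?exprn_gt0 ?mulr_gt0//.
by rewrite -natrX ler_nat.
Qed.

(** The right-hand side tends to zero, so that the grid step exceeds
    [4 * radius m] for large [m]. *)
Lemma radiusE m : (0 < m)%N ->
  4 * radius m * (m ^ (4 * k + 3))%:R = 4 * 6 ^+ d.+1 / m%:R.
Proof.
move=> m0; have m_neq0 : m%:R != 0 :> R by rewrite pnatr_eq0 -lt0n.
rewrite /radius exprMn natrX exprVn -exprM.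
have -> : (mesh_exp * d.+1 = (mesh_exp * d + 1) + (4 * k + 3) + 1)%N.
  by rewrite /mesh_exp; lia.
rewrite !exprD !invfM; field.
by rewrite m_neq0 ?expf_neq0.
Qed.

(** The two sides count the pairs of balls and the grid points; the exponents
    are [8 * k ^ 2 + 10 * k + 2] and [8 * k ^ 2 + 10 * k + 3]. *)
Lemma grid_larger m : (1 < m)%N ->
  (m ^ (mesh_exp * k + 1) * m ^ (mesh_exp * k + 1) <
     (m ^ (4 * k + 3)) ^ (2 * k + 1))%N.
Proof.
by move=> m1; rewrite -expnD -expnM ltn_exp2l// /mesh_exp; lia.
Qed.

Lemma perturb_tests_for_piece (F G : set ncompact) mF mG m0 s q
    (T : 'I_(2 * k + 1) -> set 'rV[R]_d.+1) (tau : R) :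
  family_cover mF F -> family_cover mG G -> 0 < tau ->
  (forall i, lebesgue_measurable (T i)) ->
  exists (T' : 'I_(2 * k + 1) -> set 'rV[R]_d.+1) (gamma : R),
    [/\ 0 < gamma, forall i, lebesgue_measurable (T' i),
        forall i, (lebesgue_rV (symdiff (T i) (T' i)) <= tau%:E)%E &
        forall A B, pair_piece F G m0 s q A B -> exists i, gamma <=
          `|fine (lebesgue_rV (A `&` T' i)) - fine (lebesgue_rV (B `&` T' i))|].
Proof.
move=> covF covG tau0 mT.
have [S [sigma [sigma0 sigma_tau S1 SP]]] :=
  exists_slabs (@cube_lo_lt_hi R d.+1 s q) tau0.
(* beyond m1 the grid of mesh sigma / m ^ (4 * k + 3) is coarse enough *)
pose m1 := Num.truncn (4 * 6 ^+ d.+1 / sigma).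
pose m := (maxn (maxn mF mG) (maxn m0 m1)).+2.
have mFm : (mF < m)%N by rewrite /m; lia.
have mGm : (mG < m)%N by rewrite /m; lia.
have m0m : (m0 < m)%N by rewrite /m; lia.
have m1m : (m1 < m)%N by rewrite /m; lia.
have m_gt1 : (1 < m)%N by rewrite /m; lia.
have m_gt0 : 0 < m%:R :> R by rewrite ltr0n; lia.
have [MF [cF [MFm FcF]]] := covF m mFm.
have [MG [cG [MGm GcG]]] := covG m mGm.
pose in_ball (c : ncompact) A :=
  exists2 K : ncompact, sval K = A & dball dist c (m%:R ^- mesh_exp) K.
pose class (uv : 'I_MF * 'I_MG) A B :=
  in_ball (cF uv.1) A /\ in_ball (cG uv.2) B.
have in_ball_setD c A A' : in_ball c A -> in_ball c A' -> thin_boundary m0 A' ->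
    (lebesgue_rV (A `\` A') <= (radius m)%:E)%E.
  by move=> [K <- cK] [K' <- cK'] thinK'; exact: radius_setD m0m thinK' cK cK'.
have radius0 : 0 < radius m.
  by rewrite mulr_gt0 ?exprn_gt0// mulr_gt0// invr_gt0 exprn_gt0.
have [|//|||//|||T' [mT' TT' sep]] := @perturb_tests R _ (@lebesgue_rV R d.+1)
  (2 * k + 1) (m ^ (4 * k + 3)) ('I_MF * 'I_MG)%type T S sigma (radius m)
  (pair_piece F G m0 s q) class.
- rewrite card_prod !card_ord; apply: leq_ltn_trans (grid_larger m_gt1).
  exact: leq_mul.
- rewrite radiusE; last by lia.
  rewrite ler_pdivrMr// [leRHS]mulrC -ler_pdivrMr//.
  by apply: le_trans (ltW (truncnS_gt _)) _; rewrite ler_nat.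
- exact: mT.
- move=> A B PAB; have [Aoo Boo] := pair_piece_lty PAB.
  have [K [L [KA LB FK GL [_ _ cubeA cubeB]]]] := PAB; split => //.
  + exact: subset_trans S1 cubeA.
  + by rewrite -subset0 -cubeB; exact: setSI.
  + have [u _ uK] := FcF K FK; have [v _ vL] := GcG L GL.
    by exists (u, v); split; [exists K|exists L].
- move=> [u v] A B A' B' _ [_ [_ [_ _ _ _ [thinA' thinB' _ _]]]].
  move=> [uA vB] [uA' vB'].
  by split; [exact: in_ball_setD uA uA' _|exact: in_ball_setD vB vB' _].
exists T', (radius m); split => //.
by move=> i; apply: le_trans (TT' i) _; rewrite lee_fin.
Qed.

End Reconstruction.

Theorem theorem7p2 (R : realType) (d : nat) (hd : (0 < d)%N)
    (k : nat) (hk : (0 < k)%N) (C : set (ncompact R d))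
    (hdimP : (packing_dim (@ncompact_dist R d) C <= (k%:R)%:E)%E)
    (hreg : forall K, C K -> sval K = closure (interior (sval K)))
    (hbd : forall K, C K ->
       upper_box_dim (@eucl_dist R d) (boundary (sval K)) = (d%:R - 1)%:E) :
  reconstructible [set sval K | K in C] (2 * k + 1).
Proof.
case: d hd C hdimP hreg hbd => // d _ C hdimP hreg hbd.
pose N := @mesh_exp k.
have N0 : (0 < N)%N by rewrite /N /mesh_exp; lia.
have exponent p : ((p%:R)%:E < ((N * p + 1)%:R / N%:R)%:E :> \bar R)%E.
  by rewrite lte_fin ltr_pdivlMr ?ltr0n// -natrM ltr_nat mulnC addn1.
have [F [CF dimF]] :=
  packing_dim_lt_cover (le_lt_trans hdimP (exponent k)).
have [mF covF] : {mF & forall i, @family_cover R d k (mF i) (F i)}.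
  apply: (choice (P := fun i m0 => @family_cover R d k m0 (F i))) => i.
  exact: upper_box_dim_lt_cover N0 (dimF i).
have thin K : C K -> exists m0, @thin_boundary R d k m0 (sval K).
  move=> CK; apply: upper_box_dim_lt_cover N0 _.
  by rewrite (hbd K CK) -natr1 addrK; exact: exponent.
(* the pieces are indexed by codes j of countable data *)
pose P j A B := if unpickle j is Some (i, i', m0, s, q)
  then @pair_piece R d k (F i) (F i') m0 s q A B else False.
have [T [mT sep]] : exists T : 'I_(2 * k + 1) -> set 'rV[R]_d.+1,
    (forall i, lebesgue_measurable (T i)) /\ forall j A B, P j A B -> exists i,
      lebesgue_rV (A `&` T i) <> lebesgue_rV (B `&` T i).
  apply: (@exists_separating_tests R _ (@lebesgue_rV R d.+1)).
    move=> j A B; rewrite /P; case: unpickle => // -[[[[i i'] m0] s] q].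
    exact: pair_piece_lty.
  move=> j T tau tau0 mT; rewrite /P.
  case: unpickle => [[[[[i i'] m0] s] q]|].
    exact: perturb_tests_for_piece (covF i) (covF i') tau0 mT.
  exists T, 1; split => // i; rewrite /symdiff setDv setU0.
  by rewrite outer_measure0 lee_fin ltW.
exists T; split => // _ _ [K CK <-] [L CL <-] eqT.
have subset_of (K' L' : ncompact R d.+1) : C K' -> C L' ->
    (forall i, lebesgue_rV (sval K' `&` T i) = lebesgue_rV (sval L' `&` T i)) ->
    sval K' `<=` sval L'.
  move=> CK' CL' eqT'; apply: contrapT => nKL.
  have clL : closed (sval L') by rewrite (hreg _ CL'); exact: closed_closure.
  have [s [q [cubeK cubeL]]] := exists_cube_in_setD (hreg _ CK') clL nKL.
  have [i _ FK] := CF _ CK'; have [i' _ FL] := CF _ CL'.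
  have [mK thinK] := thin _ CK'; have [mL thinL] := thin _ CL'.
  have [|t] := sep (pickle (i, i', maxn mK mL, s, q)) (sval K') (sval L').
    rewrite /P pickleK; exists K', L'; split => //; split => //.
      exact: thin_boundaryS (leq_maxl _ _) thinK.
    exact: thin_boundaryS (leq_maxr _ _) thinL.
  by apply.
by apply/seteqP; split; apply: subset_of.
Qed.
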